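(* Let $a>0$ and $1<p<\infty$. There exists a constant $C>0$ such that, for every cube $Q\in\mathcal{Q}_a$, every $\sigma>0$ and every $f\in \mathrm{JN}_p(\mathbb{R}^d,\gamma)$, $$\gamma\left(\{x\in Q: |f(x)-f_Q|>\sigma\}\right)\leq C\left(\frac{K_p^{\mathcal{Q}_a}(f)}{\sigma}\right)^p.$$
   Context: $\gamma$ is the Gaussian probability measure on $\mathbb{R}^d$, $d\gamma(x)=\pi^{-d/2}e^{-|x|^2}dx$. Cubes are open with sides parallel to the coordinate axes; $c_Q$ and $\ell_Q$ denote the center and side length of a cube $Q$. Let $m(0)=1$ and $m(x)=\min\{1,1/|x|\}$ for $x\neq 0$. For $a>0$, $\mathcal{Q}_a$ is the family of all cubes $Q\subset\mathbb{R}^d$ with $\ell_Q\leq a\,m(c_Q)$. Write $f_Q=\frac{1}{\gamma(Q)}\int_Q f\,d\gamma$. For $a>0$, $1<p<\infty$ and $f\in L^1(\mathbb{R}^d,\gamma)$ put $$K_p^{\mathcal{Q}_a}(f)=\sup\left(\sum_i\gamma(Q_i)\left(\frac{1}{\gamma(Q_i)}\int_{Q_i}|f-f_{Q_i}|\,d\gamma\right)^p\right)^{1/p},$$ the supremum being over all countable collections $\{Q_i\}$ of pairwise disjoint cubes in $\mathcal{Q}_a$. The space $\mathrm{JN}_p^{\mathcal{Q}_a}(\mathbb{R}^d,\gamma)$ consists of all $f\in L^1(\mathbb{R}^d,\gamma)$ with $K_p^{\mathcal{Q}_a}(f)<\infty$, with norm $\|f\|_{\mathrm{JN}_p^{\mathcal{Q}_a}(\mathbb{R}^d,\gamma)}=\|f\|_{L^1(\mathbb{R}^d,\gamma)}+K_p^{\mathcal{Q}_a}(f)$.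 Up to equivalence of norms this space does not depend on $a>0$, and it is denoted $\mathrm{JN}_p(\mathbb{R}^d,\gamma)$. *)

(* Defs.v *)
From HB Require Import structures.
From mathcomp Require Import all_boot all_order all_algebra.
From mathcomp Require Import all_classical all_reals all_analysis.
From mathcomp Require Import measurable_realfun.

Set Implicit Arguments.
Unset Strict Implicit.
Unset Printing Implicit Defensive.

Import Order.TTheory GRing.Theory Num.Theory.
Import numFieldNormedType.Exports.

Local Open Scope classical_set_scope.
Local Open Scope ring_scope.

(* R^d is d.-tuple R with its product Borel sigma-algebra.  Lebesgue measure
   on R^d.+1 is the image of the product of the Lebesgue measures on R and R^d
   under (x, t) |-> x :: t; on the one-point space R^0 it is the Dirac mass. *)
Section lebesgue_tuple.
Context {R : realType}.

Definition tuple_cons n (p : R * n.-tuple R) : n.+1.-tuple R :=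
  [tuple of p.1 :: p.2].

Lemma measurable_tuple_cons n :
  measurable_fun [set: R * n.-tuple R] (@tuple_cons n).
Proof. exact: measurable_cons. Qed.

Section step.
Variables (n : nat) (mu : {sigma_finite_measure set (n.-tuple R) -> \bar R}).

Definition lebesgue_cons : set (n.+1.-tuple R) -> \bar R :=
  pushforward (lebesgue_measure \x mu)%E (@tuple_cons n).

Let lebesgue_cons0 : lebesgue_cons set0 = 0%E.
Proof. by rewrite /lebesgue_cons /pushforward preimage_set0 measure0. Qed.

Let lebesgue_cons_ge0 A : (0 <= lebesgue_cons A)%E.
Proof. by rewrite /lebesgue_cons /pushforward measure_ge0. Qed.

Let lebesgue_cons_sigma_additive : semi_sigma_additive lebesgue_cons.
Proof.
move=> F mF tF mUF; rewrite /lebesgue_cons /pushforward preimage_bigcup.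
have mp A : measurable A -> measurable (@tuple_cons n @^-1` A).
  by move=> mA; rewrite -[X in measurable X]setTI; exact: measurable_tuple_cons.
apply: measure_semi_sigma_additive.
- by move=> k; exact: mp.
- apply/trivIsetP => /= i j _ _ ij; rewrite -preimage_setI.
  by move/trivIsetP : tF => /(_ _ _ _ _ ij) ->//; rewrite preimage_set0.
- by rewrite -preimage_bigcup; exact: mp.
Qed.

HB.instance Definition _ := isMeasure.Build _ _ _ lebesgue_cons
  lebesgue_cons0 lebesgue_cons_ge0 lebesgue_cons_sigma_additive.

Let lebesgue_cons_sigma_finite : sigma_finite setT lebesgue_cons.
Proof.
have /sigma_finiteP[F [FT ndF mF]] := sigma_finiteT (@lebesgue_measure R).
have /sigma_finiteP[G [GT ndG mG]] := sigma_finiteT mu.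
pose h (t : n.+1.-tuple R) : R * n.-tuple R := (thead t, [tuple of behead t]).
have hK : cancel (@tuple_cons n) h.
  by move=> [x t]; rewrite /h theadE; congr pair; exact: val_inj.
have mh : measurable_fun setT h.
  apply: measurable_fun_pair; first exact: (measurable_tnth ord0).
  exact: measurable_behead.
exists (fun k => h @^-1` (F k `*` G k)).
  rewrite -preimage_bigcup -[LHS](preimage_setT h); congr preimage.
  rewrite -setXTT FT GT predeqE => -[x y]; split.
    move=> [/= [i _ Fix] [j _ Gjy]]; exists (maxn i j) => //; split.
    - by move: x Fix; exact/subsetPset/ndF/leq_maxl.
    - by move: y Gjy; exact/subsetPset/ndG/leq_maxr.
  by move=> [i _ []/= ? ?]; split; exists i.
move=> k; have [mFk Fk] := mF k; have [mGk Gk] := mG k; split.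
  by rewrite -[X in measurable X]setTI; apply: mh => //; exact: measurableX.
rewrite /lebesgue_cons /pushforward -comp_preimage.
rewrite (_ : h \o _ = id) ?preimage_id; last by apply/funext => x /=; rewrite hK.
by rewrite product_measure1E// lte_mul_pinfty// ge0_fin_numE.
Qed.

HB.instance Definition _ := Measure_isSigmaFinite.Build _ _ _ lebesgue_cons
  lebesgue_cons_sigma_finite.

End step.

Fixpoint lebesgue_tuple (d : nat) :
    {sigma_finite_measure set (d.-tuple R) -> \bar R} :=
  match d with
  | 0 => \d_([tuple] : 0.-tuple R)
  | n.+1 => lebesgue_cons (lebesgue_tuple n)
  end.

End lebesgue_tuple.

Definition enorm {R : realType} {d : nat} (x : d.-tuple R) : R :=
  Num.sqrt (\sum_(i < d) tnth x i ^+ 2).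

Lemma sqr_enorm {R : realType} {d : nat} (x : d.-tuple R) :
  enorm x ^+ 2 = \sum_(i < d) tnth x i ^+ 2.
Proof. by rewrite sqr_sqrtr// sumr_ge0// => i _; exact: sqr_ge0. Qed.

Section gaussian.
Context {R : realType} (d : nat).

Definition gauss_density (x : d.-tuple R) : R :=
  pi `^ (- (d%:R / 2)) * expR (- enorm x ^+ 2).

Lemma gauss_density_ge0 x : 0 <= gauss_density x.
Proof. by rewrite mulr_ge0 ?powR_ge0 ?expR_ge0. Qed.

Lemma measurable_gauss_density : measurable_fun setT gauss_density.
Proof.
apply: measurable_funM => //; apply: measurableT_comp => //.
apply: measurableT_comp => //; under eq_fun do rewrite sqr_enorm.
by apply: measurable_sum => i; apply: measurable_funX; exact: measurable_tnth.
Qed.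

Definition gauss : set (d.-tuple R) -> \bar R :=
  fun A => (\int[lebesgue_tuple d]_(x in A) (gauss_density x)%:E)%E.

Let gauss0 : gauss set0 = 0%E.
Proof. by rewrite /gauss integral_set0. Qed.

Let gauss_ge0 A : (0 <= gauss A)%E.
Proof. by apply: integral_ge0 => x _; rewrite lee_fin gauss_density_ge0. Qed.

Let gauss_sigma_additive : semi_sigma_additive gauss.
Proof.
move=> A mA tA mUA; rewrite /gauss ge0_integral_bigcup//=; last 2 first.
- apply: measurable_funTS; apply/measurable_EFinP.
  exact: measurable_gauss_density.
- by move=> x _; rewrite lee_fin gauss_density_ge0.
apply: is_cvg_ereal_nneg_natsum_cond => n _ _; exact: gauss_ge0.
Qed.

HB.instance Definition _ := isMeasure.Build _ _ _ gauss
  gauss0 gauss_ge0 gauss_sigma_additive.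

End gaussian.

Section gaussian_probability.
Context {R : realType}.

Lemma ge0_integral_lebesgue_cons n (f : n.+1.-tuple R -> \bar R) :
  measurable_fun setT f -> (forall x, 0 <= f x)%E ->
  (\int[lebesgue_tuple n.+1]_x f x =
   \int[lebesgue_measure]_x \int[lebesgue_tuple n]_t f (tuple_cons (x, t)))%E.
Proof.
move=> mf f0.
transitivity (\int[lebesgue_measure \x lebesgue_tuple n]_z f (tuple_cons z))%E.
  transitivity (\int[pushforward (lebesgue_measure \x lebesgue_tuple n)
      (@tuple_cons R n)]_x f x)%E; first by [].
  by rewrite ge0_integral_pushforward//; exact: measurable_tuple_cons.
rewrite fubini_tonelli1//.
exact: measurableT_comp mf (measurable_tuple_cons (n := n)).
Qed.

Lemma gauss_density_cons n (x : R) (t : n.-tuple R) :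
  gauss_density (tuple_cons (x, t)) =
  (pi `^ (- 2^-1) * gauss_fun x) * gauss_density t.
Proof.
rewrite /gauss_density /gauss_fun !sqr_enorm big_ord_recl/= opprD expRD.
rewrite mulrACA; congr (_ * (_ * expR (- _))).
  rewrite -powRD; last by rewrite (gt_eqF (pi_gt0 R)) implybT.
  by congr (_ `^ _); rewrite -natr1 mulrDl mul1r opprD addrC.
by apply: eq_bigr => i _; rewrite tnthS.
Qed.

Lemma gauss_setT d : gauss [set: d.-tuple R] = 1%E.
Proof.
have mg k : measurable_fun setT (fun t : k.-tuple R => (gauss_density t)%:E).
  by apply/measurable_EFinP; exact: measurable_gauss_density.
elim: d => [|n IHn]; rewrite /gauss.
  rewrite /= integral_dirac// ?diracT ?mul1e; last exact: mg.
  rewrite /gauss_density sqr_enorm big_ord0.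
  by rewrite mul0r !oppr0 powRr0 expR0 mulr1.
rewrite ge0_integral_lebesgue_cons//; last first.
  by move=> x; rewrite lee_fin gauss_density_ge0.
have c0 : 0 <= (pi `^ (- 2^-1) : R) by exact: powR_ge0.
transitivity (\int[@lebesgue_measure R]_x
    ((pi `^ (- 2^-1))%:E * (gauss_fun x)%:E))%E.
  apply: eq_integral => x _.
  under eq_integral do rewrite gauss_density_cons EFinM.
  rewrite ge0_integralZl//; last 3 first.
  - exact: mg.
  - by move=> t _; rewrite lee_fin gauss_density_ge0.
  - by rewrite lee_fin mulr_ge0// gauss_fun_ge0.
  by rewrite [X in (_ * X)%E]IHn mule1 EFinM.
rewrite ge0_integralZl//; last 2 first.
- by apply/measurable_EFinP; exact: measurable_gauss_fun.
- by move=> x _; rewrite lee_fin gauss_fun_ge0.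
rewrite integralT_gauss -EFinM powRN powR12_sqrt ?pi_ge0//.
by rewrite mulVf// gt_eqF// sqrtr_gt0 pi_gt0.
Qed.

HB.instance Definition _ d :=
  @Measure_isProbability.Build _ _ R (@gauss R d) (gauss_setT d).

End gaussian_probability.

Section john_nirenberg.
Context {R : realType} {d : nat}.
Implicit Types (a p : R) (f : d.-tuple R -> R).

Record cube := Cube {
  cube_center : d.-tuple R;
  cube_side : R;
  cube_side_gt0 : 0 < cube_side }.

Definition cube_set (Q : cube) : set (d.-tuple R) :=
  [set x | forall i, `|tnth x i - tnth (cube_center Q) i| < cube_side Q / 2].

(* Written by cases because 0^-1 = 0 here, while m(0) = 1. *)
Definition gauss_scale (x : d.-tuple R) : R :=
  if enorm x == 0 then 1 else Num.min 1 (enorm x)^-1.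

Definition admissible a : set cube :=
  [set Q | cube_side Q <= a * gauss_scale (cube_center Q)].

Definition cube_mean f (Q : cube) : R :=
  (fine (gauss (cube_set Q)))^-1 * \int[@gauss R d]_(x in cube_set Q) f x.

Definition mean_osc f (Q : cube) : \bar R :=
  ((fine (gauss (cube_set Q)))^-1%:E *
   \int[@gauss R d]_(x in cube_set Q) `|f x - cube_mean f Q|%:E)%E.

(* A countable collection of cubes is a family (Q i) indexed by i in a set D of
   naturals, finite or not; the values of Q outside D play no role. *)
Definition JN_K a p f : \bar R :=
  ereal_sup [set s | exists (D : set nat) (Q : nat -> cube),
    [/\ forall i, D i -> admissible a (Q i),
        trivIset D (fun i => cube_set (Q i)) &
        s = ((\sum_(i <oo | i \in D)
                gauss (cube_set (Q i)) * mean_osc f (Q i) `^ p) `^ p^-1)%E]].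

Definition JN_at a p f : Prop :=
  (@gauss R d).-integrable setT (EFin \o f) /\ (JN_K a p f < +oo)%E.

(* The space JN_at a p does not depend on a > 0; the existential avoids
   singling out a value of a. *)
Definition JN p f : Prop := exists2 a, 0 < a & JN_at a p f.

End john_nirenberg.

Arguments cube : clear implicits.

(* Main.v *)
Require Import Defs.
From mathcomp Require Import all_boot all_order all_algebra.
From mathcomp Require Import all_classical all_reals all_analysis.
From mathcomp Require Import measurable_realfun.
From mathcomp Require Import ring lra.

Import Order.TTheory GRing.Theory Num.Theory.
Import numFieldNormedType.Exports.

(* Fix M large in terms of a and d, and split Q repeatedly into M^d congruent
   subcubes: all the cubes obtained are again in Q_a, and the Gaussian measure
   of a cube is at most D times that of each of its children, because
   exp(-|x|^2) is essentially constant on Q.  Let E_s be the union of the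
   maximal cubes on which the mean of |f - f_Q| exceeds s.  A Calderon-Zygmund
   comparison of E_s with E_{2Ds} gives
     D s gamma(E_{2Ds}) <= sum_j gamma(Q_j) osc(Q_j)
   over the maximal cubes Q_j of E_s; since the p-th powers sum to at most K^p,
   induction along the levels s = (2D)^k s_0 yields gamma(E_s) <= C (K / s)^p.
   Everything is done with cubes of bounded generation, with constants
   independent of the generation.  In place of Lebesgue differentiation,
   {|f - f_Q| > 2s} is approximated in measure by a union of cubes of one
   generation: a cube of mean at most s is filled at most half by it. *)

Set Implicit Arguments.
Unset Strict Implicit.
Unset Printing Implicit Defensive.

Local Open Scope classical_set_scope.
Local Open Scope ring_scope.

(** * Stopping-time decomposition on a tree *)

Section tree.
Context {R : realType} {I : finType}.
Implicit Types (w v : seq I) (n : nat) (s : R).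

(** Nodes are words of digits with the newest digit in front: the root is [[::]] and the children of
    [w] are the words [i :: w]. *)
Definition tree_additive (nu : seq I -> R) :=
  forall w, nu w = \sum_(i : I) nu (i :: w).

Fixpoint generation n w : seq (seq I) :=
  if n is m.+1 then flatten [seq generation m (i :: w) | i <- enum I]
  else [:: w].

Lemma sum_flatten_enum (F : seq I -> R) (h : I -> seq (seq I)) :
  \sum_(v <- flatten [seq h i | i <- enum I]) F v =
  \sum_(i : I) \sum_(v <- h i) F v.
Proof. by rewrite big_flatten/= big_map big_enum. Qed.

Lemma sum_generation nu n w : tree_additive nu ->
  \sum_(v <- generation n w) nu v = nu w.
Proof.
move=> nuD; elim: n w => [|n IHn] w /=; first by rewrite big_seq1.
by rewrite sum_flatten_enum nuD; apply: eq_bigr => i _; exact: IHn.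
Qed.

Lemma size_generation n w v : v \in generation n w -> size v = (n + size w)%N.
Proof.
elim: n w => [|n IHn] w /=; first by rewrite inE => /eqP ->.
by case/flatten_mapP => i _ /IHn ->; rewrite addnS.
Qed.

Variables mu F : seq I -> R.

(* The maximal nodes of average [F / mu] larger than [s] among those at depth
   at most [n] below [w]. *)
Fixpoint stopped s n w : seq (seq I) :=
  if s * mu w < F w then [:: w] else
  if n is m.+1 then flatten [seq stopped s m (i :: w) | i <- enum I] else [::].

Definition stopped_mass s n w := \sum_(v <- stopped s n w) mu v.

Lemma sum_stopped_le (nu : seq I -> R) s n w :
  tree_additive nu -> (forall w, 0 <= nu w) ->
  \sum_(v <- stopped s n w) nu v <= nu w.
Proof.
move=> nuD nu0; elim: n w => [|n IHn] w /=; case: ifP => _.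
- by rewrite big_seq1.
- by rewrite big_nil.
- by rewrite big_seq1.
- by rewrite sum_flatten_enum nuD; apply: ler_sum => i _; exact: IHn.
Qed.

Lemma stopped_lt s n w v : v \in stopped s n w -> s * mu v < F v.
Proof.
elim: n w => [|n IHn] w /=; case: ifPn => h; rewrite ?inE.
- by move/eqP => ->.
- by [].
- by move/eqP => ->.
- by case/flatten_mapP => i _ /IHn.
Qed.

Hypotheses (muD : tree_additive mu) (mu_gt0 : forall w, 0 < mu w).
Hypotheses (FD : tree_additive F) (F_ge0 : forall w, 0 <= F w).

(** A node of average above [s] is a stopped node or lies below one, and the nodes of one generation
    below a stopped node have by additivity at most its mass. *)
Lemma sum_generation_le s n w :
  \sum_(v <- generation n w | s * mu v < F v) mu v <= stopped_mass s n w.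
Proof.
have sub k u : \sum_(v <- generation k u | s * mu v < F v) mu v <= mu u.
  rewrite -[leRHS](sum_generation k u muD) [leRHS](bigID (fun v => s * mu v < F v))/=.
  by rewrite lerDl sumr_ge0// => v _; exact: ltW.
rewrite /stopped_mass; elim: n w => [|n IHn] w /=; case: ifPn => h.
- by rewrite big_cons h big_nil addr0 big_seq1.
- by rewrite big_cons (negbTE h) !big_nil.
- by rewrite [leRHS]big_seq1; exact: (sub n.+1).
- rewrite sum_flatten_enum big_flatten/= big_map big_enum/=.
  by apply: ler_sum => i _; exact: IHn.
Qed.

Variable D : R.
Hypothesis doubling : forall i w, mu w <= D * mu (i :: w).

(** In the application [mu], [F] and [G v] integrate over a cell the functions 1, |f - f_Q| and |f -
    f_v|, where f_v is the mean over the cube of [v]; [F_le_G] is then the triangle inequality, with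
    |f_v - f_Q| at most [F v / mu v]. *)
Variable G : seq I -> seq I -> R.
Hypotheses (GD : forall v, tree_additive (G v)) (G_ge0 : forall v w, 0 <= G v w).
Hypothesis F_le_G : forall v u, F u <= G v u + F v / mu v * mu u.

(** Each [v] stopped at level [b * s] satisfies [b * s * mu v < F v <= G w v + D * s * mu v].
    Subtract the last term and sum over these nodes, on which [G w] adds up to at most [G w w]. *)
Lemma stopped_mass_le b s n w : 0 < s -> F w <= D * s * mu w ->
  (b - D) * s * stopped_mass (b * s) n w <= G w w.
Proof.
move=> s0 Fw; apply: (le_trans _ (sum_stopped_le (b * s) n w (GD w) (G_ge0 w))).
rewrite mulr_sumr big_seq [leRHS]big_seq; apply: ler_sum => v /stopped_lt Fv.
have Fw' : F w / mu w * mu v <= D * s * mu v.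
  by rewrite ler_pM2r// ler_pdivrMr.
have := F_le_G w v; rewrite -mulrA mulrBl; move: Fv Fw'; rewrite -!mulrA; lra.
Qed.

(** Descend to the nodes stopped at level [s] and apply [stopped_mass_le] there. A node not stopped
    at [s] is not stopped at [b * s] either, and doubling passes the bound on [F] to its children:
    [F (i :: w) <= F w <= s * mu w <= D * s * mu (i :: w)]. *)
Lemma stopped_mass_le_osc b s n w : 1 <= b -> 0 < s ->
  F w <= D * s * mu w ->
  (b - D) * s * stopped_mass (b * s) n w <= \sum_(v <- stopped s n w) G v v.
Proof.
move=> b1 s0; elim: n w => [|n IHn] w Fw.
  have := stopped_mass_le b 0 s0 Fw; rewrite /stopped_mass /=.
  case: (ltP (s * mu w)) => h; first by rewrite big_seq1.
  rewrite ltNge (le_trans h) ?big_nil ?mulr0//= ler_pM2r//.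
  by rewrite ler_peMl// ltW.
have := stopped_mass_le b n.+1 s0 Fw; rewrite /stopped_mass /=.
case: (ltP (s * mu w)) => h; first by rewrite big_seq1.
rewrite ltNge (le_trans h) /=; last by rewrite ler_pM2r// ler_peMl// ltW.
move=> _; rewrite !sum_flatten_enum mulr_sumr; apply: ler_sum => i _.
apply: IHn; rewrite (@le_trans _ _ (F w))//.
  by rewrite (FD w) (bigD1 i)//= lerDl sumr_ge0.
rewrite (le_trans h)//; have := doubling i w; rewrite -(ler_pM2l s0); lra.
Qed.

(* Young's inequality in the form [o <= o^p t^(p-1) + 1/t]; it replaces
   Hoelder's inequality and makes the recursion on levels linear. *)
Lemma le_powR_add (p t o : R) : 1 < p -> 0 < t -> 0 <= o ->
  o <= o `^ p * t `^ (p - 1) + t^-1.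
Proof.
move=> p1 t0 o0; case: (leP o t^-1) => h.
  by rewrite (le_trans h)// lerDr mulr_ge0 ?powR_ge0.
have o1 : 0 < o by rewrite (lt_trans _ h)// invr_gt0.
rewrite -[p in o `^ p](subrK 1) [in o `^ _]powRD; last by rewrite (gt_eqF o1) implybT.
rewrite powRr1// mulrAC -powRM ?(ltW t0)//.
apply: ler_wpDr; first by rewrite invr_ge0 ltW.
have e1 : 1 `^ (p - 1) = 1 :> R by rewrite powR1.
rewrite ler_peMl// -{1}e1 ge0_ler_powR ?nnegrE ?subr_ge0 ?(ltW p1)//.
  by rewrite mulr_ge0// ltW.
by rewrite -ler_pdivrMr// mul1r ltW.
Qed.

Hypothesis D_ge1 : 1 <= D.
Variables p Kp : R.
Hypothesis p_gt1 : 1 < p.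
Hypothesis Kp_ge : forall s n,
  \sum_(v <- stopped s n [::]) mu v * (G v v / mu v) `^ p <= Kp.
Hypothesis Kp_root : mu [::] * (F [::] / mu [::]) `^ p <= Kp.

(** The choice [b = 2 * D] gives [b - D = D]. Young's inequality splits the oscillations into [p]-th
    powers, controlled by [Kp], and a multiple of the mass stopped at the lower level. *)
Lemma stopped_mass_step s n : 0 < s -> F [::] <= D * s * mu [::] ->
  forall t, 0 < t ->
  D * s * stopped_mass (2 * D * s) n [::] <=
    t `^ (p - 1) * Kp + stopped_mass s n [::] / t.
Proof.
move=> s0 Fs t t0; have b1 : 1 <= 2 * D by move: D_ge1; lra.
have := @stopped_mass_le_osc (2 * D) s n [::].
rewrite (_ : 2 * D - D = D); last by lra.
move=> /(_ _ s0 Fs) H; have {}H := H b1; apply: (le_trans H).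
apply: (@le_trans _ _ (t `^ (p - 1) *
    (\sum_(v <- stopped s n [::]) mu v * (G v v / mu v) `^ p) +
    stopped_mass s n [::] / t)).
  rewrite mulr_sumr /stopped_mass mulr_suml -big_split/=.
  apply: ler_sum => v _; have muv := mu_gt0 v.
  have o0 : 0 <= G v v / mu v by rewrite divr_ge0// ltW.
  have := ler_wpM2l (ltW muv) (le_powR_add p_gt1 t0 o0).
  by rewrite mulrDr (_ : mu v * (G v v / mu v) = G v v) 1?mulrC ?divfK ?gt_eqF//; lra.
by rewrite lerD2r ler_pM2l ?powR_gt0.
Qed.

Lemma stopped_mass_weak s n : 0 < s ->
  stopped_mass s n [::] <= (2 * (2 * D) `^ p) `^ p * Kp / s `^ p.
Proof.
(* [c] is such that the recursion [stopped_mass_step], taken with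
   [t = c * (2 * D) / s], contracts by the factor 1/2. *)
set c := 2 * (2 * D) `^ p; set m0 := F [::] / mu [::].
have D1 := D_ge1; have p1 := p_gt1.
have b0 : 0 < 2 * D by lra.
have p0 : 0 < p by lra.
have bp0 : 0 < (2 * D) `^ p by rewrite powR_gt0.
have c0 : 0 < c by rewrite mulr_gt0.
have Kp0 : 0 <= Kp.
  by rewrite (le_trans _ Kp_root)// mulr_ge0 ?powR_ge0// ltW.
have c2 : 2 <= c.
  have := @ler_powR R (2 * D) _ 0 p (ltW p0); rewrite powRr0 => h.
  by rewrite ler_peMr// h//; lra.
(* At low levels the trivial bound by [mu [::]] suffices: [t <= c * m0] because [2 <= c], and
   [Kp_root] concludes. *)
have small t : 0 < t -> t <= 2 * m0 ->
    stopped_mass t n [::] <= c `^ p * Kp / t `^ p.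
  move=> t0 tm; apply: (le_trans (sum_stopped_le _ _ _ muD (fun w => ltW (mu_gt0 w)))).
  rewrite ler_pdivlMr ?powR_gt0//.
  have m00 : 0 <= m0 by lra.
  have tc : t `^ p <= c `^ p * m0 `^ p.
    rewrite -powRM ?(ltW c0)// ge0_ler_powR ?nnegrE ?(ltW p0) ?(ltW t0)//.
      by rewrite mulr_ge0// ltW.
    by rewrite (le_trans tm)// ler_wpM2r.
  apply: (@le_trans _ _ (mu [::] * (c `^ p * m0 `^ p))).
    by rewrite ler_pM2l.
  by rewrite mulrCA ler_pM2l ?powR_gt0.
(* If [m0 = 0], no multiple of [m0] reaches [s]; but then [s] times the stopped mass is at most [F
   [::] = 0]. *)
move=> s0; have [m00|m0n] := eqVneq m0 0.
  apply: (@le_trans _ _ 0); last by rewrite divr_ge0 ?mulr_ge0 ?powR_ge0.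
  have F00 : F [::] = 0.
    by move/eqP: m00; rewrite mulf_eq0 invr_eq0 (gt_eqF (mu_gt0 _)) orbF => /eqP.
  rewrite -(pmulr_rle0 _ s0) -F00.
  apply: le_trans (sum_stopped_le s n [::] FD F_ge0).
  rewrite mulr_sumr big_seq [leRHS]big_seq; apply: ler_sum => v.
  by move/stopped_lt/ltW.
have m0gt0 : 0 < m0 by rewrite lt0r m0n divr_ge0// ltW.
have [k sk] : exists k, s <= (2 * D) ^+ k * m0.
  exists (Num.bound (s / m0)); rewrite -ler_pdivrMr//.
  apply: (@le_trans _ _ ((Num.bound (s / m0))%:R)).
    by rewrite ltW// archi_boundP// divr_ge0 ?ltW.
  apply: (@le_trans _ _ (2 ^+ Num.bound (s / m0))).
    by rewrite -natrX ler_nat ltnW// ltn_expl.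
  by apply: lerXn2r; rewrite ?nnegrE//; lra.
elim: k s s0 sk => [|k IHk] s s0 sk; first by apply: small => //; lra.
(* Above [2 * m0], the level [s' = s / (2 * D)] satisfies [m0 <= D * s'], which is what
   [stopped_mass_step] requires to pass from [s'] to [s]. *)
case: (leP s (2 * m0)) => h; first exact: small.
have s'0 : 0 < s / (2 * D) by rewrite divr_gt0.
have /(IHk _ s'0) IH : s / (2 * D) <= (2 * D) ^+ k * m0.
  by rewrite ler_pdivrMr// mulrAC -exprSr.
set s' := s / (2 * D) in s'0 IH *; set Y := leRHS.
have YE : c `^ p * Kp / s' `^ p = Y * c / 2.
  have s'p : s `^ p = s' `^ p * (2 * D) `^ p.
    by rewrite -powRM ?(ltW s'0) ?(ltW b0)// /s' divfK ?gt_eqF.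
  rewrite /Y s'p {3}/c; field.
  by rewrite !gt_eqF ?powR_gt0.
have ss' : 2 * D * s' = s by rewrite /s' mulrC divfK ?gt_eqF.
have t0 : 0 < c / s' by rewrite divr_gt0.
have := stopped_mass_step n s'0 _ t0; rewrite ss'.
have tE : (c / s') `^ (p - 1) * Kp = Y * s' / 2.
  rewrite powRB ?gt_eqF// ?powRr1 ?(ltW t0)//.
  have cE : c `^ p = (c / s') `^ p * s' `^ p.
    by rewrite -powRM ?(ltW s'0) ?(ltW t0)// divfK ?gt_eqF.
  transitivity (c `^ p * Kp / s' `^ p * s' / c).
    by rewrite cE; field; rewrite !gt_eqF ?powR_gt0.
  by rewrite YE; field; rewrite gt_eqF.
have IH2 : stopped_mass s' n [::] / (c / s') <= Y * s' / 2.
  rewrite ler_pdivrMr// (le_trans IH)// YE.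
  rewrite (_ : Y * c / 2 = Y * s' / 2 * (c / s'))//.
  by field; rewrite gt_eqF.
rewrite tE => H; have {}H : D * s' * stopped_mass s n [::] <= s' * Y.
  apply: (le_trans (H _)); last by lra.
  rewrite -ler_pdivrMr// -/m0.
  by move: h; lra.
rewrite mulrAC [s' * Y]mulrC ler_pM2r// in H.
apply: le_trans H; rewrite ler_peMl// /stopped_mass sumr_ge0// => v _.
exact: ltW.
Qed.
End tree.

(** * Approximation of measurable sets by cells of a tree *)

Section cells.
Context {disp : measure_display} {T : measurableType disp} {R : realType}.
Context (mu : {finite_measure set T -> \bar R}) {J : finType}.
Variable cell : seq J -> set T.
Hypothesis mcell : forall w, measurable (cell w).
Hypothesis cell_child : forall w x, cell w x <-> exists i, cell (i :: w) x.
Hypothesis cell_inj : forall w i j x, cell (i :: w) x -> cell (j :: w) x -> i = j.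
Implicit Types (A B X : set T) (w v : seq J).

Lemma cell_bigsetU w : cell w = \big[setU/set0]_(i <- enum J) cell (i :: w).
Proof.
rewrite -bigcup_seq; apply/seteqP; split => x.
  by move/cell_child => [i xi]; exists i => //=; rewrite mem_enum.
by case=> i _ xi; apply/cell_child; exists i.
Qed.

Lemma trivIset_cell w (D : set J) : trivIset D (fun i => cell (i :: w)).
Proof. by move=> i j _ _ [x [xi xj]]; exact: cell_inj xi xj. Qed.

Lemma tree_additive_measure X : measurable X ->
  tree_additive (fun w => fine (mu (cell w `&` X))).
Proof.
move=> mX w; rewrite cell_bigsetU -bigcup_seq setI_bigcupl.
rewrite measure_fin_bigcup//; last 2 first.
- by move=> i j _ _ [x [[xi _] [xj _]]]; exact: cell_inj xi xj.
- by move=> i _; exact: measurableI.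
rewrite -fsbig_seq ?enum_uniq// big_enum/= sum_fine// => i _.
by rewrite fin_num_measure//; exact: measurableI.
Qed.

Lemma sub_cell_cons w i : cell (i :: w) `<=` cell w.
Proof. by move=> x xi; apply/cell_child; exists i. Qed.

Lemma sub_cell_root w : cell w `<=` cell [::].
Proof. by elim: w => // i w IHw x /sub_cell_cons /IHw. Qed.

Lemma tree_additive_Rintegral (h : T -> R) :
  (forall x, 0 <= h x) -> mu.-integrable (cell [::]) (EFin \o h) ->
  tree_additive (fun w => \int[mu]_(x in cell w) h x).
Proof.
move=> h0 ih w; have iw v : mu.-integrable (cell v) (EFin \o h).
  by apply: integrableS ih => //; exact: sub_cell_root.
rewrite /Rintegral {1}cell_bigsetU ge0_integral_bigsetU ?enum_uniq//.
- rewrite big_enum/= sum_fine// => i _; exact: integrable_fin_num.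
- exact: trivIset_cell.
- by rewrite -cell_bigsetU; exact: measurable_int (iw w).
- by move=> x _; rewrite lee_fin.
Qed.

(** The point mass at [x]: inserted in [sum_stopped_le], it shows that at most one stopped cell
    contains [x]. *)
Lemma tree_additive_count x : tree_additive (fun w => (`[< cell w x >])%:R : R).
Proof.
move=> w; case: asboolP => [|nx].
  move=> /cell_child[i xi]; rewrite (bigD1 i)//= asboolT// big1 ?addr0// => j ji.
  by rewrite asboolF// => xj; case/eqP: ji; exact: cell_inj xj xi.
by rewrite big1// => i _; rewrite asboolF// => /sub_cell_cons.
Qed.

Definition symdiff A B := (A `\` B) `|` (B `\` A).

(** Inside the root cell, these sets are the unions of cells of generation [n]. *)
Definition resolved n X :=
  forall v, size v = n -> cell v `<=` X \/ cell v `&` X = set0.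

Definition approximable A := forall e : R, 0 < e -> exists n X,
  [/\ measurable X, resolved n X & (mu (cell [::] `&` symdiff A X) < e%:E)%E].

Lemma resolvedS n X : resolved n X -> resolved n.+1 X.
Proof.
move=> rX [//|i v [/rX[vX|vX]]]; [left|right].
  by apply: subset_trans vX; exact: sub_cell_cons.
by apply: subsetI_eq0 vX => //; exact: sub_cell_cons.
Qed.

Lemma resolved_leq n m X : (n <= m)%N -> resolved n X -> resolved m X.
Proof.
move=> /subnK <- rX; elim: (m - n)%N => // k IHk.
by rewrite addSn; exact: resolvedS.
Qed.

Lemma resolvedC n X : resolved n X -> resolved n (~` X).
Proof.
move=> rX v /rX[vX|vX]; [right|left].
  by apply/disjoints_subset; rewrite setCK.
exact/disjoints_subset.
Qed.

Lemma resolvedU n X Y : resolved n X -> resolved n Y -> resolved n (X `|` Y).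
Proof.
move=> rX rY v vn; have [vX|vX] := rX v vn; first by left => x /vX; left.
have [vY|vY] := rY v vn; first by left => x /vY; right.
by right; rewrite setIUr vX vY setU0.
Qed.

Lemma measurable_symdiff A B : measurable A -> measurable B ->
  measurable (symdiff A B).
Proof. by move=> mA mB; apply: measurableU; exact: measurableD. Qed.

Lemma approximable_resolved n X : measurable X -> resolved n X -> approximable X.
Proof.
move=> mX rX e e0; exists n, X; split => //.
by rewrite /symdiff setDv setU0 setI0 measure0.
Qed.

Lemma approximableC A : approximable A -> approximable (~` A).
Proof.
move=> hA e /hA[n [X [mX rX AX]]]; exists n, (~` X); split.
- exact: measurableC.
- exact: resolvedC.
- rewrite (_ : symdiff _ _ = symdiff A X)// /symdiff.
  by rewrite !setDE !setCK setUC [~` X `&` _]setIC [~` A `&` _]setIC.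
Qed.

(** Closedness in the pseudometric given by the measure of the symmetric difference, by its triangle
    inequality. *)
Lemma approximable_le A : measurable A ->
  (forall e : R, 0 < e -> exists B, [/\ measurable B, approximable B &
     (mu (cell [::] `&` symdiff A B) < e%:E)%E]) -> approximable A.
Proof.
move=> mA hA e e0; have e20 : 0 < e / 2 by rewrite divr_gt0.
have [B [mB hB AB]] := hA _ e20; have [n [X [mX rX BX]]] := hB _ e20.
exists n, X; split => //; rewrite [e in e%:E]splitr EFinD.
apply: le_lt_trans (lteD AB BX).
apply: le_trans (measureU2 mu _ _); last 2 first.
- by apply: measurableI => //; exact: measurable_symdiff.
- by apply: measurableI => //; exact: measurable_symdiff.
apply: le_measure; rewrite ?inE.
- by apply: measurableI => //; exact: measurable_symdiff.
- by apply: measurableU; apply: measurableI => //; exact: measurable_symdiff.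
move=> x [Qx AX]; have [Bx|Bx] := pselect (B x).
- by case: AX => -[a b]; [right|left]; split => //; [left|right].
- by case: AX => -[a b]; [left|right]; split => //; [left|right].
Qed.

Lemma approximableU A B : measurable A -> measurable B ->
  approximable A -> approximable B -> approximable (A `|` B).
Proof.
move=> mA mB hA hB e e0; have e20 : 0 < e / 2 by rewrite divr_gt0.
have [n [X [mX rX AX]]] := hA _ e20; have [m [Y [mY rY BY]]] := hB _ e20.
exists (maxn n m), (X `|` Y); split; first exact: measurableU.
  by apply: resolvedU; [exact: resolved_leq (leq_maxl _ _) rX|
    exact: resolved_leq (leq_maxr _ _) rY].
rewrite [e in e%:E]splitr EFinD; apply: le_lt_trans (lteD AX BY).
apply: le_trans (measureU2 mu _ _); last 2 first.
- by apply: measurableI => //; exact: measurable_symdiff.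
- by apply: measurableI => //; exact: measurable_symdiff.
apply: le_measure; rewrite ?inE.
- by apply: measurableI => //; apply: measurable_symdiff; exact: measurableU.
- by apply: measurableU; apply: measurableI => //; exact: measurable_symdiff.
move=> x [Qx [[[Ax|Bx] /not_orP[nX nY]]|[[Xx|Yx] /not_orP[nA nB]]]].
- by left; split => //; left.
- by right; split => //; left.
- by left; split => //; right.
- by right; split => //; right.
Qed.

(** Finite unions are approximable, and they converge in measure to the whole union: the differences
    [D N] decrease to the empty set and [mu] is finite. *)
Lemma approximable_bigcup (A : nat -> set T) : (forall i, measurable (A i)) ->
  (forall i, approximable (A i)) -> approximable (\bigcup_i A i).
Proof.
move=> mA hA; have mB N : measurable (\big[setU/set0]_(i < N) A i).
  exact: bigsetU_measurable.
have mU : measurable (\bigcup_i A i) by exact: bigcup_measurable.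
apply: approximable_le => // e e0.
pose D N := cell [::] `&` (\bigcup_i A i `\` \big[setU/set0]_(i < N) A i).
have mD N : measurable (D N) by apply: measurableI => //; exact: measurableD.
have D0 : \bigcap_N D N = set0.
  rewrite -subset0 => x Dx; have [_ [[i _ Ax] _]] := Dx 0%N I.
  have [_ [_]] := Dx i.+1 I; apply; rewrite -bigcup_mkord; exists i => //=.
have : mu \o D @ \oo --> mu (\bigcap_N D N).
  apply: nonincreasing_cvg_mu => //.
  - by rewrite -ge0_fin_numE// fin_num_measure.
  - by rewrite D0.
  - apply/nonincreasing_seqP => N; apply/subsetPset => x [Qx [Ux nx]].
    by do 2 split => // ; move=> h; apply: nx; rewrite big_ord_recr/=; left.
rewrite D0 measure0 => /fine_cvgP[_ /cvgrPdist_lt /(_ _ e0)[N _ /(_ _ (leqnn _))]].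
rewrite /= sub0r normrN ger0_norm ?fine_ge0// => DN.
exists (\big[setU/set0]_(i < N) A i); split => //.
  elim: N {DN} => [|N IHN].
    have r0 : resolved 0 set0 by move=> v _; right; rewrite setI0.
    by rewrite big_ord0; exact: approximable_resolved measurable0 r0.
  by rewrite big_ord_recr/=; exact: approximableU (mB N) (mA N) IHN (hA N).
rewrite (_ : _ `&` symdiff _ _ = D N).
  by rewrite -(fineK (fin_num_measure mu _ (mD N))) lte_fin.
congr (_ `&` _); rewrite /symdiff [X in _ `|` X](_ : _ = set0) ?setU0//.
rewrite -subset0 => x [Bx]; apply; move: Bx; rewrite -bigcup_mkord => -[i _ Ax].
by exists i.
Qed.

(** Cells of generation [n] with mean above [s] contribute at most the stopped mass. On any other
    cell [v], the part in [E] is at most the part in [symdiff E X]: this is clear if [v] misses [X];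
    if [v] lies in [X], the part in [E] has at most the mass of the part outside [E]. The errors add
    up to less than [e]. *)
Lemma approximable_mass_le (h : T -> R) (s M : R) :
  let mass w := fine (mu (cell w)) in
  let F w := \int[mu]_(x in cell w) h x in
  let E := [set x | 2 * s <= h x] in
  (forall w, 0 < mass w) ->
  (forall x, 0 <= h x) -> mu.-integrable (cell [::]) (EFin \o h) ->
  0 < s -> measurable E -> approximable E ->
  (forall n, stopped_mass mass F s n [::] <= M) ->
  fine (mu (cell [::] `&` E)) <= M.
Proof.
move=> mass F E mass0 h0 ih s0 mE aE HM.
have fin A : measurable A -> mu A \is a fin_num by exact: fin_num_measure.
have massD : tree_additive mass.
  have := @tree_additive_measure setT measurableT.
  by rewrite /mass; under eq_fun do rewrite setIT.
apply/ler_addgt0Pr => e /aE[n [X [mX rX EX]]].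
have mEX : measurable (symdiff E X) by exact: measurable_symdiff.
rewrite -(sum_generation n [::] (tree_additive_measure mE)).
apply: (@le_trans _ _ (\sum_(v <- generation n [::])
    ((if s * mass v < F v then mass v else 0) +
     fine (mu (cell v `&` symdiff E X))))).
  rewrite big_seq [leRHS]big_seq; apply: ler_sum => v /size_generation.
  rewrite addn0 => vn.
  have mvE : measurable (cell v `&` E) by exact: measurableI.
  have mvEX : measurable (cell v `&` symdiff E X) by exact: measurableI.
  case: ltP => Fv.
    rewrite ler_wpDr ?fine_ge0// fine_le ?fin//.
    by apply: le_measure; rewrite ?inE//; exact: subIsetl.
  rewrite add0r; have [vX|vX] := rX v vn; last first.
    rewrite fine_le ?fin//; apply: le_measure; rewrite ?inE// => x [vx Ex].
    split=> //; left; split => // Xx.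
    by have : (cell v `&` X) x by []; rewrite vX.
  have mvE' : measurable (cell v `\` E) by exact: measurableD.
  have vE : mass v = fine (mu (cell v `&` E)) + fine (mu (cell v `\` E)).
    rewrite -fineD ?fin// -measureU//; first by rewrite setUIDK.
    by rewrite setDE setIACA setICr setI0.
  (* Chebyshev's inequality for [h] on [cell v]. *)
  have : 2 * s * fine (mu (cell v `&` E)) <= F v.
    have iv : mu.-integrable (cell v) (EFin \o h).
      by apply: integrableS ih => //; exact: sub_cell_root.
    have := @le_integral_comp_abse _ _ _ mu (cell v) (mcell v) (EFin \o h)
      (2 * s) id (@measurable_id _ _ _) (fun _ => id) (fun _ _ _ _ => id).
    move=> /(_ (measurable_int _ iv)) => H; have {H} := H ltac:(by rewrite mulr_gt0).
    rewrite (_ : _ `&` _ = cell v `&` E); last first.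
      congr (_ `&` _); apply/seteqP; split => x /=;
      by rewrite lee_fin ger0_norm.
    rewrite (_ : (\int[mu]_(x in cell v) _)%E = (F v)%:E).
      by move=> H; rewrite -lee_fin EFinM fineK// fin.
    rewrite /F /Rintegral fineK; last exact: integrable_fin_num.
    by apply: eq_integral => x _ /=; rewrite ger0_norm.
  have : fine (mu (cell v `\` E)) <= fine (mu (cell v `&` symdiff E X)).
    rewrite fine_le ?fin//; apply: le_measure; rewrite ?inE// => x [vx Ex].
    by split=> //; right; split => //; exact: vX.
  move=> H1 H2; suff : s * fine (mu (cell v `&` E)) <= s * fine (mu (cell v `\` E)).
    by rewrite ler_pM2l// => /le_trans; apply.
  by move: Fv H1 H2; rewrite vE; nra.
rewrite big_split/= -big_mkcond/=; apply: lerD.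
  exact: le_trans (sum_generation_le F massD mass0 s n [::]) (HM n).
rewrite (sum_generation n [::] (tree_additive_measure mEX)).
by rewrite -lee_fin fineK ?ltW// fin//; exact: measurableI.
Qed.
End cells.

(** * Gaussian measure of cubes and their subdivisions *)

Section box.
Context {R : realType}.

Definition box {d} (a : d.-tuple R) (s : R) : set (d.-tuple R) :=
  [set x | forall j, tnth a j <= tnth x j < tnth a j + s].

Lemma measurable_box d (a : d.-tuple R) s : measurable (box a s).
Proof.
rewrite (_ : box a s = \bigcap_(j in [set: 'I_d])
    ((@tnth d R ^~ j) @^-1` `[tnth a j, tnth a j + s[)).
  apply: fin_bigcap_measurable => // j _; rewrite -[X in measurable X]setTI.
  exact: measurable_tnth.
by apply/seteqP; split => x /= h j; [move=> _|]; have := h j; rewrite /= in_itv/=;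
  last apply.
Qed.

Lemma lebesgue_tupleS n A : @lebesgue_tuple R n.+1 A =
  (lebesgue_measure \x lebesgue_tuple n)%E (@tuple_cons R n @^-1` A).
Proof. by []. Qed.

Lemma lebesgue_box d (a : d.-tuple R) s : 0 < s ->
  lebesgue_tuple d (box a s) = (s ^+ d)%:E.
Proof.
move=> s0; elim: d a => [|n IHn] a.
  rewrite (_ : box a s = setT) /= ?diracT//.
  by apply/seteqP; split => // x _ [].
rewrite lebesgue_tupleS (_ : _ @^-1` _ =
    `[thead a, thead a + s[ `*` box [tuple of behead a] s).
  rewrite product_measure1E//=; last exact: measurable_box.
  rewrite IHn lebesgue_measure_itv/= lte_fin ltrDl s0 -EFinD.
  by rewrite addrAC subrr add0r -EFinM -exprS.
apply/seteqP; split => [[x t]/= xt|[x t]/= [xa ta] j].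
  split=> [|j]; first by have := xt ord0; rewrite in_itv/= /thead.
  by have := xt (lift ord0 j); rewrite [in tnth a _](tuple_eta a) !tnthS.
have [i ->|->] := unliftP ord0 j.
  by have := ta i; rewrite [in tnth a _](tuple_eta a) !tnthS.
by move: xa; rewrite in_itv/= /thead.
Qed.

Lemma lebesgue_hyperplane d (j : 'I_d) (t : R) :
  lebesgue_tuple d [set x | tnth x j = t] = 0%E.
Proof.
elim: d j => [[]//|n IHn] j; have [i ->|->] := unliftP ord0 j.
  rewrite lebesgue_tupleS (_ : _ @^-1` _ = setT `*` [set x | tnth x i = t]).
    rewrite product_measure1E//; first by rewrite [X in (_ * X)%E]IHn mule0.
    rewrite (_ : [set x | _] = (@tnth n R ^~ i) @^-1` [set t])//.
    by rewrite -[X in measurable X]setTI; exact: measurable_tnth.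
  by apply/seteqP; split => -[x u]/=; rewrite tnthS// => -[].
rewrite lebesgue_tupleS (_ : _ @^-1` _ = [set t] `*` setT).
  rewrite product_measure1E// [X in (X * _)%E](_ : _ = 0%E) ?mul0e//.
  exact: lebesgue_measure_set1.
by apply/seteqP; split => -[x u]/= => [|[]].
Qed.

Lemma gauss_null d (A : set (d.-tuple R)) : measurable A ->
  lebesgue_tuple d A = 0%E -> gauss A = 0%E.
Proof.
move=> mA A0; apply: null_set_integral => //.
by apply: measurable_funTS; apply/measurable_EFinP; exact: measurable_gauss_density.
Qed.

Lemma gauss_bounds d (A : set (d.-tuple R)) (m M : R) : measurable A -> 0 <= m ->
  (forall x, A x -> m <= gauss_density x <= M) ->
  (m%:E * lebesgue_tuple d A <= gauss A <= M%:E * lebesgue_tuple d A)%E.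
Proof.
move=> mA m0 Am.
have mg : measurable_fun A (fun x => (gauss_density x)%:E).
  by apply: measurable_funTS; apply/measurable_EFinP; exact: measurable_gauss_density.
rewrite -!integral_cst//; apply/andP; split; apply: ge0_le_integral => //;
  by move=> x /Am/andP[? ?]; rewrite /= lee_fin; lra.
Qed.

End box.

(** * Subdivision of a cube into congruent half-open subcubes *)

Section subcubes.
Context {R : realType} {d m : nat}.
Implicit Types Q : cube R d.
Notation digits := {ffun 'I_d -> 'I_m.+1}.

Definition lower Q : d.-tuple R :=
  [tuple tnth (cube_center Q) j - cube_side Q / 2 | j < d].

(* Half-open, so that the subcubes partition the cube exactly; this differs
   from the open cube [cube_set Q] by a null set. *)
Definition half_open Q : set (d.-tuple R) := box (lower Q) (cube_side Q).

Lemma subcube_side_gt0 Q : 0 < cube_side Q / m.+1%:R.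
Proof. by rewrite divr_gt0 ?cube_side_gt0. Qed.

(** Each side is cut into [m.+1] parts and [i j] is the position along axis [j]; the term [2^-1]
    leads from the lower corner of the subcube to its center. *)
Definition subcube Q (i : digits) : cube R d :=
  Cube [tuple tnth (lower Q) j + cube_side Q * ((i j)%:R + 2^-1) / m.+1%:R | j < d]
    (subcube_side_gt0 Q).

Definition descendant Q (w : seq digits) : cube R d :=
  foldr (fun i P => subcube P i) Q w.

Lemma lower_subcube Q i j : tnth (lower (subcube Q i)) j =
  tnth (lower Q) j + (cube_side Q / m.+1%:R) * (i j)%:R.
Proof.
by rewrite !tnth_mktuple /= ?tnth_mktuple; field; rewrite nat1r pnatr_eq0.
Qed.

(** The digits of the subcube containing [x] are the integer parts of its coordinates, measured from
    the lower corner in units of the small side; the strict upper bound in [half_open] keeps them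
    below [m.+1]. *)
Lemma half_open_subcube Q x :
  half_open Q x <-> exists i, half_open (subcube Q i) x.
Proof.
have s0 := subcube_side_gt0 Q; set s := (cube_side Q / m.+1%:R) in s0 *.
have sE : cube_side Q = s * m.+1%:R by rewrite divfK.
split=> [Qx|[i xi] j]; last first.
  have := xi j; rewrite lower_subcube /= -/s sE => /andP[h1 h2].
  have h3 : s * (i j).+1%:R <= s * m.+1%:R by rewrite ler_pM2l// ler_nat.
  have h4 : 0 <= s * (i j)%:R by rewrite mulr_ge0// ltW.
  by rewrite -natr1 in h3; apply/andP; split; lra.
pose k j := Num.truncn ((tnth x j - tnth (lower Q) j) / s).
have kP j : (k j)%:R <= (tnth x j - tnth (lower Q) j) / s < (k j).+1%:R.
  by apply: truncn_itv; rewrite divr_ge0 ?(ltW s0)// subr_ge0; case/andP: (Qx j).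
have km j : (k j < m.+1)%N.
  rewrite -(ltr_nat R); have /andP[h _] := kP j; apply: le_lt_trans h _.
  by rewrite ltr_pdivrMr// ltrBlDl mulrC -sE; case/andP: (Qx j).
exists [ffun j => inord (k j)] => j; rewrite lower_subcube ffunE inordK//= -/s.
have /andP[] := kP j; rewrite ler_pdivlMr// ltr_pdivrMr// -natr1 => h1 h2.
by apply/andP; split; lra.
Qed.

Lemma half_open_subcube_inj Q i i' x :
  half_open (subcube Q i) x -> half_open (subcube Q i') x -> i = i'.
Proof.
have s0 := subcube_side_gt0 Q; set s := (cube_side Q / m.+1%:R) in s0 *.
have tr k j : half_open (subcube Q k) x ->
    Num.truncn ((tnth x j - tnth (lower Q) j) / s) = k j.
  move=> /(_ j); rewrite lower_subcube /= -/s => /andP[h1 h2]; apply: truncn_def.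
  by rewrite ler_pdivlMr// ltr_pdivrMr// -natr1; apply/andP; split; lra.
by move=> xi xi'; apply/ffunP => j; apply/val_inj; rewrite /= -(tr i j)// (tr i' j).
Qed.

Lemma measurable_half_open Q : measurable (half_open Q).
Proof. exact: measurable_box. Qed.

Lemma cube_set_sub Q : cube_set Q `<=` half_open Q.
Proof.
move=> x Qx j; have := Qx j; rewrite tnth_mktuple ltr_norml => /andP[h1 h2].
by apply/andP; split; lra.
Qed.

Lemma measurable_hyperplane (j : 'I_d) t :
  measurable [set x : d.-tuple R | tnth x j = t].
Proof.
rewrite (_ : [set x | _] = (@tnth d R ^~ j) @^-1` [set t])//.
by rewrite -[X in measurable X]setTI; exact: measurable_tnth.
Qed.

Lemma half_openE Q : half_open Q = cube_set Q `|`
  (half_open Q `&` \bigcup_(j in [set: 'I_d]) [set x | tnth x j = tnth (lower Q) j]).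
Proof.
apply/seteqP; split=> x; last by case=> [/cube_set_sub|[]].
move=> Qx; have [xQ|/existsNP[j xj]] := pselect (cube_set Q x); first by left.
right; split => //; exists j => //=; have := Qx j; rewrite tnth_mktuple => /andP[h1 h2].
apply/eqP; rewrite eq_le h1 andbT leNgt; apply/negP => h3; apply: xj.
by rewrite ltr_norml; apply/andP; split; lra.
Qed.

(** The difference lies in the hyperplanes carrying the lower faces, which are Lebesgue null. *)
Lemma half_open_diff_null Q : exists N : set (d.-tuple R),
  [/\ measurable N, gauss N = 0%E & half_open Q `\` cube_set Q `<=` N].
Proof.
pose H j := [set x : d.-tuple R | tnth x j = tnth (lower Q) j].
have mH j : measurable (H j) by exact: measurable_hyperplane.
exists (\bigcup_(j in [set: 'I_d]) H j); split.
- exact: fin_bigcup_measurable.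
- apply/eqP; rewrite eq_le measure_ge0 andbT.
  have := @content_sub_fsum _ _ _ (@gauss R d) _ [set: 'I_d]
    (\bigcup_(j in [set: 'I_d]) H j) H (@finite_finset _ _) (fun j _ => mH j).
  rewrite fsbig1; last first.
    by move=> j _; apply: gauss_null => //; exact: lebesgue_hyperplane.
  by apply=> //; exact: fin_bigcup_measurable.
- by move=> x [Qx nx]; move: Qx; rewrite half_openE => -[|[]].
Qed.

Lemma measurable_cube_set Q : measurable (cube_set Q).
Proof.
rewrite (_ : cube_set Q = \bigcap_(j in [set: 'I_d]) ((@tnth d R ^~ j) @^-1`
   `]tnth (lower Q) j, tnth (lower Q) j + cube_side Q[)).
  apply: fin_bigcap_measurable => // j _; rewrite -[X in measurable X]setTI.
  exact: measurable_tnth.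
have Qj x j : (`|tnth x j - tnth (cube_center Q) j| < cube_side Q / 2) =
    (tnth x j \in `]tnth (lower Q) j, tnth (lower Q) j + cube_side Q[).
  rewrite in_itv/= tnth_mktuple ltr_norml.
  by apply/idP/idP => /andP[? ?]; apply/andP; split; lra.
apply/seteqP; split => x /= h j; first by move=> _; rewrite /= -Qj.
by rewrite Qj; exact: h.
Qed.

Lemma gauss_half_open Q : gauss (half_open Q) = gauss (cube_set Q).
Proof.
have mQ := measurable_cube_set Q; have mH := measurable_half_open Q.
have [N [mN N0 HN]] := half_open_diff_null Q; apply/eqP; rewrite eq_le.
apply/andP; split; last first.
  by apply: le_measure; rewrite ?inE//; exact: cube_set_sub.
rewrite -[leRHS]adde0 -N0; apply: le_trans (measureU2 _ mQ mN).
apply: le_measure; rewrite ?inE//; first exact: measurableU.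
by move=> x Hx; have [?|?] := pselect (cube_set Q x); [left|right; exact: HN].
Qed.

Lemma integral_half_open Q (h : d.-tuple R -> R) :
  (@gauss R d).-integrable setT (EFin \o h) ->
  (\int[@gauss R d]_(x in half_open Q) (h x)%:E =
   \int[@gauss R d]_(x in cube_set Q) (h x)%:E)%E.
Proof.
move=> ih; have [N [mN N0 HN]] := half_open_diff_null Q.
have mQ := measurable_cube_set Q; have mH := measurable_half_open Q.
rewrite (negligible_integral mN mH _ N0); last exact: integrableS ih.
rewrite [RHS](negligible_integral mN mQ _ N0); last exact: integrableS ih.
congr (integral _ _ _); apply/seteqP; split => x [Qx Nx]; split => //.
  by apply: contrapT => nx; apply: Nx; exact: HN.
exact: cube_set_sub.
Qed.

End subcubes.

(** * Gaussian density on admissible cubes *)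

Section admissible_cubes.
Context {R : realType} {d : nat}.
Implicit Types (Q P : cube R d) (x y : d.-tuple R) (a : R).

Lemma ler_tnth_enorm x i : `|tnth x i| <= enorm x.
Proof.
rewrite -sqrtr_sqr ler_wsqrtr// (bigD1 i)//= lerDl sumr_ge0// => j _.
exact: sqr_ge0.
Qed.

Lemma enorm_ge0 x : 0 <= enorm x.
Proof. exact: sqrtr_ge0. Qed.

Lemma gauss_scale_gt0 x : 0 < gauss_scale x.
Proof.
rewrite /gauss_scale; case: ifPn => // x0.
by rewrite lt_min ltr01 invr_gt0 lt_neqAle eq_sym x0 enorm_ge0.
Qed.

Lemma gauss_scale_le1 x : gauss_scale x <= 1.
Proof. by rewrite /gauss_scale; case: ifPn => // _; rewrite ge_min lexx. Qed.

Lemma gauss_scaleM_le1 x : gauss_scale x * enorm x <= 1.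
Proof.
rewrite /gauss_scale; case: ifPn => [/eqP ->|x0]; first by rewrite mulr0.
rewrite -[leRHS](mulVf x0) ler_wpM2r ?enorm_ge0//.
by rewrite ge_min lexx orbT.
Qed.

Lemma le_gauss_scale r x : r <= 1 -> r * enorm x <= 1 -> r <= gauss_scale x.
Proof.
move=> r1 rx; rewrite /gauss_scale; case: ifPn => // x0.
by rewrite le_min r1 -[_^-1]mul1r ler_pdivlMr// lt_neqAle eq_sym x0 enorm_ge0.
Qed.

(* Bounds the oscillation of [|x|^2] on the cubes of [Q_a]. *)
Definition osc_bound a : R := d%:R * (a ^+ 2 / 4 + a).

Lemma osc_bound_ge0 a : 0 <= a -> 0 <= osc_bound a.
Proof. by move=> a0; rewrite mulr_ge0// addr_ge0// mulr_ge0// sqr_ge0. Qed.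

(** With side [s] and center [c], each |x_i^2 - c_i^2| = |x_i - c_i| |x_i + c_i| is at most
    (s/2)(s/2 + 2|c|), and admissibility gives both s <= a and s|c| <= a. *)
Lemma sqr_enorm_osc a Q x : admissible a Q -> 0 < a -> half_open Q x ->
  `|enorm x ^+ 2 - enorm (cube_center Q) ^+ 2| <= osc_bound a.
Proof.
move=> Qa a0 Qx; rewrite !sqr_enorm -sumrB.
apply: (le_trans (ler_norm_sum _ _ _)).
have s0 := cube_side_gt0 Q; set s := cube_side Q in s0 *; set c := cube_center Q in Qa *.
have m1 := gauss_scale_le1 c; have m2 := gauss_scaleM_le1 c.
have sa : s <= a by apply: le_trans Qa _; rewrite ger_pMr.
have sc : s * enorm c <= a.
  apply: (le_trans (ler_wpM2r (enorm_ge0 _) Qa)).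
  by rewrite -mulrA ger_pMr.
rewrite /osc_bound -[d in d%:R]card_ord mulr_natl -sumr_const.
apply: ler_sum => i _; rewrite subr_sqr normrM.
have xc : `|tnth x i - tnth c i| <= s / 2.
  have := Qx i; rewrite tnth_mktuple -/s -/c ler_norml => /andP[h1 h2].
  by apply/andP; split; lra.
have ci := ler_tnth_enorm c i.
have xc' : `|tnth x i + tnth c i| <= s / 2 + 2 * enorm c.
  rewrite (_ : _ + _ = (tnth x i - tnth c i) + 2 * tnth c i); last by ring.
  by rewrite (le_trans (ler_normD _ _))// lerD// normrM ger0_norm// ler_pM2l.
apply: (le_trans (ler_pM _ _ xc xc')) => //.
have : s * s <= a * a by apply: ler_pM => //; exact: ltW.
rewrite expr2; lra.
Qed.

Lemma gauss_density_osc a Q x : admissible a Q -> 0 < a -> half_open Q x ->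
  gauss_density (cube_center Q) * expR (- osc_bound a) <= gauss_density x
    <= gauss_density (cube_center Q) * expR (osc_bound a).
Proof.
move=> Qa a0 /(sqr_enorm_osc Qa a0); rewrite ler_norml => /andP[h1 h2].
have pi0 : 0 < pi `^ (- (d%:R / 2)) :> R by rewrite powR_gt0// pi_gt0.
rewrite /gauss_density -!mulrA !ler_pM2l// -!expRD !ler_expR.
by apply/andP; split; lra.
Qed.

Lemma gauss_density_gt0 x : 0 < gauss_density x.
Proof. by rewrite mulr_gt0 ?expR_gt0// powR_gt0// pi_gt0. Qed.

Lemma gauss_sub_box a Q b s : admissible a Q -> 0 < a -> 0 < s ->
  box b s `<=` half_open Q ->
  gauss_density (cube_center Q) * expR (- osc_bound a) * s ^+ d
    <= fine (gauss (box b s)) <=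
  gauss_density (cube_center Q) * expR (osc_bound a) * s ^+ d.
Proof.
move=> Qa a0 s0 bQ; set g := gauss_density _.
have := @gauss_bounds R d (box b s) (g * expR (- osc_bound a))
  (g * expR (osc_bound a)) (measurable_box _ _).
rewrite mulr_ge0 ?gauss_density_ge0 ?expR_ge0// => /(_ isT).
case/(_ _)/andP; first by move=> x /bQ; exact: gauss_density_osc.
rewrite lebesgue_box// -!EFinM -(@fineK _ (gauss _)) ?lee_fin => [-> ->//|].
by apply: fin_num_measure; exact: measurable_box.
Qed.

End admissible_cubes.

(** * The tree of subcubes: doubling and admissibility *)

Section cube_tree.
Context {R : realType} {d m : nat}.
Implicit Types (Q P : cube R d) (a : R).
Notation digits := {ffun 'I_d -> 'I_m.+1}.
Implicit Types (w : seq digits) (x : d.-tuple R).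

Definition cell Q w := half_open (descendant Q w).

Lemma measurable_cell Q w : measurable (cell Q w).
Proof. exact: measurable_half_open. Qed.

Lemma cell_child Q w x : cell Q w x <-> exists i, cell Q (i :: w) x.
Proof. exact: half_open_subcube. Qed.

Lemma cell_inj Q w i j x : cell Q (i :: w) x -> cell Q (j :: w) x -> i = j.
Proof. exact: half_open_subcube_inj. Qed.

Lemma sub_cell Q w : cell Q w `<=` half_open Q.
Proof. exact: (sub_cell_root (@cell_child Q)). Qed.

Lemma descendant_side Q w :
  cube_side (descendant Q w) = cube_side Q / m.+1%:R ^+ size w.
Proof.
elim: w => [|i w IHw] /=; first by rewrite expr0 divr1.
by rewrite IHw exprSr invfM mulrA.
Qed.

Lemma gauss_cell_gt0 a Q w : admissible a Q -> 0 < a ->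
  0 < fine (gauss (cell Q w)).
Proof.
move=> Qa a0; have s0 := cube_side_gt0 (descendant Q w).
have /andP[h _] := gauss_sub_box Qa a0 s0 (@sub_cell Q w).
apply: lt_le_trans h.
by rewrite mulr_gt0 ?exprn_gt0// mulr_gt0 ?gauss_density_gt0 ?expR_gt0.
Qed.

(** Both masses are compared with the density at the center of the root [Q], so the constant does
    not depend on the generation. *)
Lemma gauss_cell_doubling a Q w i : admissible a Q -> 0 < a ->
  fine (gauss (cell Q w)) <=
  expR (2 * osc_bound (d := d) a) * m.+1%:R ^+ d * fine (gauss (cell Q (i :: w))).
Proof.
move=> Qa a0.
have /andP[_ h1] := gauss_sub_box Qa a0 (cube_side_gt0 (descendant Q w)) (@sub_cell Q w).
have /andP[h2 _] := gauss_sub_box Qa a0 (cube_side_gt0 (descendant Q (i :: w)))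
  (@sub_cell Q (i :: w)).
apply: (le_trans h1); rewrite -ler_pdivrMl; last first.
  by rewrite mulr_gt0 ?expR_gt0// exprn_gt0.
apply: le_trans h2; rewrite /= expr_div_n expRN.
rewrite (_ : expR (2 * _) =
    expR (osc_bound (d := d) a) * expR (osc_bound (d := d) a)); last first.
  by rewrite -expRD; congr expR; ring.
have : expR (osc_bound (d := d) a) != 0 by rewrite gt_eqF ?expR_gt0.
have : (m.+1%:R : R) ^+ d != 0 by rewrite expf_neq0// pnatr_eq0.
move: (m.+1%:R ^+ d) (expR _) (cube_side _ ^+ d) => M e t M0 e0.
by rewrite le_eqVlt; apply/orP; left; apply/eqP; field; rewrite ?e0 ?M0.
Qed.

Lemma center_half_open P : half_open P (cube_center P).
Proof.
move=> j; rewrite tnth_mktuple; have := cube_side_gt0 P => s0.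
by apply/andP; split; lra.
Qed.

(** A proper descendant has side at most a m(c)/M, with c the center of [Q] and M = [m.+1]. Its
    center c' lies in [Q], so (m(c)|c'|)^2 <= (m(c)|c|)^2 + m(c)^2 B <= 1 + B <= M^2, whence m(c)/M
    <= m(c'). *)
Lemma admissible_descendant a Q w : admissible a Q -> 0 < a ->
  1 + osc_bound (d := d) a <= m.+1%:R -> admissible a (descendant Q w).
Proof.
move=> Qa a0 aM; case: w => [//|i w].
set P := descendant Q (i :: w); rewrite /admissible/=.
have B0 := @osc_bound_ge0 _ d a (ltW a0); set B := osc_bound a in aM B0 *.
set M : R := m.+1%:R in aM *; have M0 : 0 < M by rewrite ltr0n.
have M1 : 1 <= M by rewrite ler1n.
set c := cube_center Q; have m0 := gauss_scale_gt0 c.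
have sP : cube_side P <= a * (gauss_scale c / M).
  rewrite descendant_side /= exprS invfM mulrA.
  apply: (@le_trans _ _ (cube_side Q / M)); last by rewrite ?mulrA ler_pM2r ?invr_gt0.
  have l0 := cube_side_gt0 Q; rewrite ?mulrA ler_piMr ?divr_ge0 ?(ltW l0) ?(ltW M0)//.
  by rewrite invf_le1 ?exprn_gt0// exprn_ege1.
apply: (le_trans sP); rewrite ler_pM2l//; apply: le_gauss_scale.
  by rewrite ler_pdivrMr// mul1r (le_trans (gauss_scale_le1 _)).
have cP : half_open Q (cube_center P) by exact/(@sub_cell Q (i :: w))/center_half_open.
have := sqr_enorm_osc Qa a0 cP; rewrite ler_norml => /andP[_ h].
rewrite mulrAC ler_pdivrMr// mul1r -(@ler_pXn2r _ 2)// ?nnegrE ?(ltW M0)//; last first.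
  by rewrite mulr_ge0 ?enorm_ge0// ltW.
rewrite exprMn (@le_trans _ _ (gauss_scale c ^+ 2 * (enorm c ^+ 2 + B)))//.
  by rewrite ler_wpM2l ?sqr_ge0// -lerBlDl.
have m2 : gauss_scale c ^+ 2 <= 1 by rewrite expr_le1 ?gauss_scale_le1// ltW.
have mc : (gauss_scale c * enorm c) ^+ 2 <= 1.
  by rewrite expr_le1 ?gauss_scaleM_le1// mulr_ge0 ?enorm_ge0// ltW.
rewrite mulrDr -exprMn (@le_trans _ _ (1 + B))//.
  by rewrite lerD// ler_piMl.
by rewrite (le_trans aM)// expr2 ler_peMr// ltW.
Qed.

End cube_tree.

(** * Approximation of Borel sets by unions of subcubes *)

Section approximation.
Context {R : realType} {d m : nat}.
Hypothesis m_gt0 : (0 < m)%N.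
Variable Q : cube R d.
Notation digits := {ffun 'I_d -> 'I_m.+1}.
Implicit Types (w : seq digits) (A : set (d.-tuple R)).

Let grid n := cube_side Q / m.+1%:R ^+ n.

Let grid_gt0 n : 0 < grid n.
Proof. by rewrite divr_gt0 ?cube_side_gt0 ?exprn_gt0. Qed.

(** The integer [k] has the [j]-th components of the digits of [w] as its expansion in base
    [m.+1]. *)
Lemma lower_descendant w j : exists k : nat,
  tnth (lower (descendant Q w)) j =
  tnth (lower Q) j + cube_side Q / m.+1%:R ^+ size w * k%:R.
Proof.
elim: w => [|i w [k IHw]] /=; first by exists 0%N; rewrite mulr0 addr0.
exists (m.+1 * k + i j)%N; rewrite lower_subcube IHw descendant_side exprS.
have : (m.+1%:R : R) != 0 by rewrite pnatr_eq0.
have : (m.+1%:R : R) ^+ size w != 0 by rewrite expf_neq0// pnatr_eq0.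
rewrite natrD natrM; move: (m.+1%:R : R) (_ ^+ size w) => M e e0 M0.
by field; rewrite e0.
Qed.

Notation approximable := (approximable (@gauss R d) (@cell R d m Q)).

(** Replace [t] by the largest grid point [t' <= t]: the new half-space is resolved, and the error
    lies in the slab [S n]. The mesh tends to 0 since [m.+1] is at least 2, so the slabs decrease to
    the empty set. *)
Lemma approximable_half_space j (t : R) : approximable [set x | tnth x j < t].
Proof.
move=> e e0.
have mS b b' : measurable [set x : d.-tuple R | b <= tnth x j < b'].
  rewrite (_ : [set x | _] = (@tnth d R ^~ j) @^-1` `[b, b'[).
    by rewrite -[X in measurable X]setTI; exact: measurable_tnth.
  by apply/seteqP; split => x /=; rewrite in_itv.
have mH b : measurable [set x : d.-tuple R | tnth x j < b].
  rewrite (_ : [set x | _] = (@tnth d R ^~ j) @^-1` `]-oo, b[).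
    by rewrite -[X in measurable X]setTI; exact: measurable_tnth.
  by apply/seteqP; split => x /=; rewrite in_itv.
pose S n := [set x : d.-tuple R | t - grid n <= tnth x j < t].
have S0 : \bigcap_n S n = set0.
  rewrite -subset0 => x Sx.
  have /andP[_ xt] := Sx 0%N I.
  pose n := Num.bound (cube_side Q / (t - tnth x j)).
  have /andP[h _] := Sx n I.
  have tx : 0 < t - tnth x j by rewrite subr_gt0.
  suff : grid n < t - tnth x j by move: h; lra.
  rewrite /grid ltr_pdivrMr ?exprn_gt0// mulrC -ltr_pdivrMr//.
  apply: (@lt_trans _ _ n%:R).
    by rewrite archi_boundP// divr_ge0 ?ltW ?cube_side_gt0.
  by rewrite -natrX ltr_nat ltn_expl.
have : @gauss R d \o S @ \oo --> gauss (\bigcap_n S n).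
  apply: nonincreasing_cvg_mu => //.
  - by rewrite -ge0_fin_numE// fin_num_measure//; exact: mS.
  - by move=> n; exact: mS.
  - by rewrite S0.
  - apply/nonincreasing_seqP => n; apply/subsetPset => x /= /andP[h xt].
    apply/andP; split => //; rewrite (le_trans _ h)// lerB//.
    rewrite /grid ler_pM2l ?cube_side_gt0//.
    by rewrite lef_pV2 ?posrE ?exprn_gt0// exprS ler_peMl ?ler1n.
rewrite S0 measure0 => /fine_cvgP[_ /cvgrPdist_lt /(_ _ e0)[n _ /(_ _ (leqnn _))]].
rewrite /= sub0r normrN ger0_norm ?fine_ge0// => Sn.
pose F := Num.floor ((t - tnth (lower Q) j) / grid n).
pose t' := tnth (lower Q) j + grid n * F%:~R.
have t't : t' <= t < t' + grid n.
  have := floor_itv ((t - tnth (lower Q) j) / grid n).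
  rewrite -/F ler_pdivlMr// ltr_pdivrMr// intrD /t' => /andP[h1 h2].
  by apply/andP; split; lra.
exists n, [set x | tnth x j < t']; split => //.
- move=> v vn; have [k kE] := lower_descendant v j; rewrite vn -/(grid n) in kE.
  have vP x : cell Q v x -> tnth (lower Q) j + grid n * k%:R <= tnth x j
      < tnth (lower Q) j + grid n * k%:R + grid n.
    by move=> /(_ j); rewrite kE descendant_side vn.
  have [kF|kF] := ltP (k%:Z) F; [left|right].
    move=> x /vP /andP[_ h] /=; apply: (lt_le_trans h).
    have : grid n * (k%:Z + 1)%:~R <= grid n * F%:~R.
      by rewrite ler_pM2l// ler_int lezD1.
    by rewrite intrD /t' -pmulrn; lra.
  rewrite -subset0 => x [/vP /andP[h _] /=].
  have : grid n * F%:~R <= grid n * (k%:Z)%:~R by rewrite ler_pM2l// ler_int.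
  by rewrite /t' -pmulrn; lra.
- apply: (@le_lt_trans _ _ (gauss (S n))).
    apply: le_measure; rewrite ?inE.
    + by apply: measurableI; [exact: measurable_cell|exact: measurable_symdiff].
    + exact: mS.
    case/andP: t't => h1 h2 x [_ [[/= h3 /negP]|[/= h3 /negP]]]; rewrite -leNgt => h4.
      by apply/andP; split => //; lra.
    by move: (lt_le_trans h3 h1); rewrite ltNge h4.
  by rewrite -(@fineK _ (gauss (S n))) ?lte_fin// fin_num_measure//; exact: mS.
Qed.

Lemma sigma_algebra_approximable : sigma_algebra setT
  [set A | measurable A /\ approximable A].
Proof.
split=> /=.
- split=> //; have r0 : resolved (@cell R d m Q) 0 set0.
    by move=> v _; right; rewrite setI0.
  exact: approximable_resolved measurable0 r0.
- by move=> A [mA hA]; rewrite setTD; split; [exact: measurableC|exact: approximableC].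
- move=> A hA; split; first by apply: bigcup_measurable => i _; case: (hA i).
  by apply: (approximable_bigcup (@measurable_cell R d m Q) (@cell_child R d m Q)) => i;
    case: (hA i).
Qed.

(** The half-spaces [tnth x j < t] generate the Borel sets, and the approximable measurable sets
    form a sigma-algebra. *)
Lemma approximable_measurable A : measurable A -> approximable A.
Proof.
suff : measurable `<=` [set A | measurable A /\ approximable A] by move=> h /h[].
apply: smallest_sub; first exact: sigma_algebra_approximable.
elim/big_ind : _ => [//|U V hU hV B [/hU|/hV]//|j _ _ [B mB <-]].
rewrite setTI; move: mB.
have -> : (measurable : set (set R)) = (@RGenInftyO.G R).-sigma.-measurable.
  exact: RGenInftyO.measurableE.
(* The sets of reals whose preimage under the [j]-th coordinate is approximable form a
   sigma-algebra, so open rays suffice. *)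
move: B; apply: smallest_sub.
  have [h0 hC hU] := sigma_algebra_approximable; split=> [|B hB|B hB] /=.
  - by rewrite preimage_set0; exact: h0.
  - by have := hC _ hB; rewrite !setTD.
  - by rewrite preimage_bigcup; exact: hU.
move=> _ [t ->]; rewrite /= (_ : _ @^-1` _ = [set x | tnth x j < t]).
  split; last exact: approximable_half_space.
  rewrite (_ : [set x | _] = (@tnth d R ^~ j) @^-1` `]-oo, t[).
    by rewrite -[X in measurable X]setTI; exact: measurable_tnth.
  by apply/seteqP; split => x /=; rewrite in_itv.
by apply/seteqP; split => x /=; rewrite in_itv.
Qed.

End approximation.

(** * The John-Nirenberg inequality *)

Section finite_families.
Context {R : realType} {d : nat}.
Implicit Types (a p : R) (f : d.-tuple R -> R).

Lemma sum_le_JN_K a p f n (P : nat -> cube R d) :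
  (forall i, (i < n)%N -> admissible a (P i)) ->
  trivIset `I_n (fun i => cube_set (P i)) ->
  ((\sum_(i < n) gauss (cube_set (P i)) * mean_osc f (P i) `^ p) `^ p^-1
   <= JN_K a p f)%E.
Proof.
move=> aP tP; apply: ereal_sup_ubound; exists `I_n, P; split => //.
set g := fun i => (gauss (cube_set (P i)) * mean_osc f (P i) `^ p)%E.
have g0 i : (0 <= g i)%E by rewrite /g mule_ge0// poweR_ge0.
congr (_ `^ _)%E; rewrite eseries_mkcond (nneseries_split 0 n); last first.
  by move=> k _; case: ifP => // _; exact: g0.
rewrite add0n big_mkord eseries0 ?adde0; last first.
  by move=> i ni _; case: ifPn => //; rewrite inE/= ltnNge ni.
by apply: eq_bigr => i _; rewrite ifT// inE /=.
Qed.

Lemma JN_K_ge0 a p f : (0 <= JN_K a p f)%E.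
Proof.
(* The supremum includes the empty collection; [P] only supplies values outside its index set. *)
pose P (i : nat) := Cube [tuple 0 | i < d] (@ltr01 R).
apply: le_trans (@sum_le_JN_K a p f 0 P _ _) => //; exact: poweR_ge0.
Qed.

End finite_families.

(** * Mean oscillations on the tree of a cube *)

Section oscillation.
Context {R : realType} {d m : nat}.
Variables (a p : R) (Q : cube R d) (f : d.-tuple R -> R).
Hypotheses (a_gt0 : 0 < a) (p_gt1 : 1 < p) (aQ : admissible a Q).
Hypothesis m_large : 1 + osc_bound (d := d) a <= m.+1%:R.
Hypothesis intf : (@gauss R d).-integrable setT (EFin \o f).
Notation digits := {ffun 'I_d -> 'I_m.+1}.
Implicit Types (u v w : seq digits).

Let gamma : {finite_measure set (d.-tuple R) -> \bar R} := @gauss R d.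

Definition cell_mass w : R := fine (gamma (cell Q w)).

Definition cell_osc v w : R :=
  \int[gamma]_(x in cell Q w) `|f x - cube_mean f (descendant Q v)|.

Lemma integrable_sub_cst (c : R) : gamma.-integrable setT (EFin \o (fun x => f x - c)).
Proof.
have := integrableB measurableT intf
  (finite_measure_integrable_cst gamma c measurableT).
by apply: eq_integrable => // x _ /=; rewrite EFinB.
Qed.

Lemma integrable_osc (c : R) (A : set (d.-tuple R)) : measurable A ->
  gamma.-integrable A (EFin \o (fun x => `|f x - c|)).
Proof.
move=> mA; apply: (integrableS measurableT) => //.
exact: integrable_norm (integrable_sub_cst c).
Qed.

Lemma cell_mass_gt0 w : 0 < cell_mass w.
Proof. exact: gauss_cell_gt0 aQ a_gt0. Qed.

Lemma cell_massD : tree_additive cell_mass.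
Proof.
have := @tree_additive_measure _ _ _ gamma _ _ (@measurable_cell R d m Q)
  (@cell_child R d m Q) (@cell_inj R d m Q) setT measurableT.
by rewrite /cell_mass; under eq_fun do rewrite setIT.
Qed.

Lemma cell_oscD v : tree_additive (cell_osc v).
Proof.
apply: tree_additive_Rintegral => //.
- exact: measurable_cell.
- exact: cell_child.
- exact: cell_inj.
- by apply: integrable_osc; exact: measurable_cell.
Qed.

Lemma cell_osc_ge0 v w : 0 <= cell_osc v w.
Proof. exact: Rintegral_ge0. Qed.

Lemma cell_mean v : \int[gamma]_(x in cell Q v) f x =
  cell_mass v * cube_mean f (descendant Q v).
Proof.
rewrite /cube_mean -gauss_half_open -/(cell Q v) mulrA divff ?mul1r.
  by rewrite /Rintegral integral_half_open.
by rewrite gt_eqF// cell_mass_gt0.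
Qed.

(** The means over the cubes of [v] and of the root differ by at most the average of |f - f_Q| over
    [cell Q v]; the pointwise triangle inequality is then integrated over [cell Q u]. *)
Lemma cell_osc_triangle v u :
  cell_osc [::] u <= cell_osc v u + cell_osc [::] v / cell_mass v * cell_mass u.
Proof.
have mc w := @measurable_cell R d m Q w.
have ic c w : gamma.-integrable (cell Q w) (EFin \o cst c).
  exact: finite_measure_integrable_cst.
set c0 := cube_mean f (@descendant R d m Q [::]); set cv := cube_mean f (descendant Q v).
have h1 : `|cv - c0| <= cell_osc [::] v / cell_mass v.
  rewrite ler_pdivlMr ?cell_mass_gt0//.
  have iv : gamma.-integrable (cell Q v) (EFin \o (fun x => f x - c0)).
    by apply: (integrableS measurableT) => //; exact: integrable_sub_cst.
  have := le_normr_Rintegral (mc v) iv.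
  rewrite RintegralB//; [|exact: integrableS intf|exact: (ic c0 v)].
  rewrite cell_mean Rintegral_cst// -/cv -[fine _]/(cell_mass v).
  rewrite [c0 * _]mulrC -mulrBr normrM ger0_norm; last exact/ltW/cell_mass_gt0.
  by rewrite mulrC.
apply: (@le_trans _ _ (cell_osc v u + `|cv - c0| * cell_mass u)); last first.
  by rewrite lerD2l ler_wpM2r// ltW ?cell_mass_gt0.
rewrite -(Rintegral_cst gamma (mc u) `|cv - c0|) -RintegralD//;
  [|exact: integrable_osc|exact: (ic _ u)].
apply: le_Rintegral => //; first exact: integrable_osc.
  have := integrableD (mc u) (integrable_osc cv (mc u)) (ic `|cv - c0| u).
  by apply: eq_integrable.
move=> x _ /=; rewrite (_ : f x - _ = (f x - cv) + (cv - c0)) ?ler_normD//.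
by rewrite addrA subrK.
Qed.

Lemma mean_osc_cell v :
  mean_osc f (descendant Q v) = (cell_osc v v / cell_mass v)%:E.
Proof.
rewrite /mean_osc -gauss_half_open -/(cell Q v) mulrC EFinM; congr (_ * _)%E.
have io := integrable_osc (cube_mean f (descendant Q v)) (@measurable_cell R d m Q v).
rewrite /cell_osc /Rintegral fineK; last first.
  by have := integrable_fin_num (@measurable_cell R d m Q v) io; apply.
rewrite -integral_half_open//; exact: integrable_osc.
Qed.

(** Disjointness is expressed by counting the cells through each point, which also excludes
    repetitions in [vs] and is the form that [tree_additive_count] delivers. *)
Lemma sum_cell_osc_le (k : R) (vs : seq (seq digits)) : JN_K a p f = k%:E ->
  (forall x, \sum_(v <- vs) (`[< cell Q v x >])%:R <= 1 :> R) ->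
  \sum_(v <- vs) cell_mass v * (cell_osc v v / cell_mass v) `^ p <= k `^ p.
Proof.
move=> Kk disj; have p0 : 0 < p by exact: lt_trans p_gt1.
have k0 : 0 <= k by rewrite -lee_fin -Kk JN_K_ge0.
have := @sum_le_JN_K R d a p f (size vs) (fun i => descendant Q (nth [::] vs i)).
rewrite Kk; set S := (\sum_(i < size vs) _)%E.
have -> : S = (\sum_(v <- vs) cell_mass v * (cell_osc v v / cell_mass v) `^ p)%:E.
  rewrite /S (big_nth [::]) big_mkord -sumEFin; apply: eq_bigr => i _.
  rewrite mean_osc_cell -gauss_half_open [RHS]EFinM -poweR_EFin; congr (_ * _)%E.
  by rewrite /cell_mass fineK// fin_num_measure//; exact: measurable_cell.
set s := \sum_(v <- vs) _ => H.
have s0 : 0 <= s.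
  rewrite sumr_ge0// => v _; rewrite mulr_ge0 ?powR_ge0// ltW//.
  exact: cell_mass_gt0.
have : (s%:E `^ p^-1 <= k%:E)%E.
  apply: H => [i _|i j /= ilt jlt [x [/cube_set_sub xi /cube_set_sub xj]]].
    exact: admissible_descendant.
  (* A point common to two cells of different index would be counted at least twice. *)
  apply/eqP/negP => /negP ij; have := disj x.
  rewrite (big_nth [::]) big_mkord (bigD1 (Ordinal ilt))//=.
  rewrite (bigD1 (Ordinal jlt))/=; last by rewrite -val_eqE/= eq_sym.
  rewrite !asboolT//; apply/negP; rewrite -ltNge.
  apply: (@lt_le_trans _ _ (1 + 1)); first by lra.
  by rewrite lerD2l lerDl sumr_ge0.
rewrite poweR_EFin lee_fin => sk.
have := ge0_ler_powR (ltW p0); move=> /(_ (s `^ p^-1) k).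
rewrite !nnegrE powR_ge0 k0 => /(_ isT isT sk).
by rewrite -powRrM mulVf ?gt_eqF// powRr1.
Qed.

End oscillation.

Theorem theorem1p1 (R : realType) (d : nat) (hd : (0 < d)%N)
    (a p : R) (ha : 0 < a) (hp : 1 < p) :
  exists2 C : R, 0 < C &
    forall (Q : cube R d) (sigma : R) (f : d.-tuple R -> R),
      admissible a Q -> 0 < sigma -> JN p f ->
      (gauss [set x | cube_set Q x /\ (sigma < `|f x - cube_mean f Q|)%R]
        <= C%:E * (JN_K a p f * (sigma^-1)%:E) `^ p)%E.
Proof.
have p0 : 0 < p by exact: lt_trans hp.
have B0 := @osc_bound_ge0 R d a (ltW ha).
(* Large enough for [admissible_descendant]; it is also positive, so that the mesh of the
   subdivisions shrinks. *)
pose m := Num.bound (1 + osc_bound (d := d) a).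
have Bm : 1 + osc_bound (d := d) a < m%:R.
  by apply: archi_boundP; rewrite addr_ge0.
have m0 : (0 < m)%N by rewrite -(ltr_nat R) (lt_trans _ Bm)//; lra.
have mB : 1 + osc_bound (d := d) a <= m.+1%:R.
  by rewrite (le_trans (ltW Bm))// ler_nat.
pose D := expR (2 * osc_bound (d := d) a) * m.+1%:R ^+ d.
have D1 : 1 <= D.
  rewrite -[1]mulr1 ler_pM// ?exprn_ege1 ?ler1n//.
  by rewrite -expR0 ler_expR mulr_ge0.
pose A := (2 * (2 * D) `^ p) `^ p.
have A0 : 0 < A.
  by rewrite powR_gt0// mulr_gt0// powR_gt0// mulr_gt0// (lt_le_trans ltr01).
exists (A * 2 `^ p); first by rewrite mulr_gt0// powR_gt0.
move=> Q sigma f aQ s0 [a' _ [intf _]].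
have K0 := JN_K_ge0 a p f.
(* An infinite value of [JN_K a p f] makes the right-hand side [+oo]; afterwards it is a real
   [k]. *)
case KE : (JN_K a p f) K0 => [k| |] // K0; last first.
  rewrite gt0_mulye ?lte_fin ?invr_gt0// poweRyr ?gt_eqF//.
  by rewrite gt0_muley ?leey// lte_fin mulr_gt0// powR_gt0.
rewrite lee_fin in K0.
pose h x := `|f x - cube_mean f Q|.
have mh : measurable_fun setT h.
  have := measurable_int _ (integrable_osc intf (cube_mean f Q) measurableT).
  by move/measurable_EFinP.
have mE : measurable [set x | 2 * (sigma / 2) <= h x].
  rewrite (_ : [set x | _] = h @^-1` `[2 * (sigma / 2), +oo[).
    by rewrite -[X in measurable X]setTI; exact: mh.
  by apply/seteqP; split => x /=; rewrite in_itv/= andbT.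
have mE' : measurable [set x | sigma < h x].
  rewrite (_ : [set x | _] = h @^-1` `]sigma, +oo[).
    by rewrite -[X in measurable X]setTI; exact: mh.
  by apply/seteqP; split => x /=; rewrite in_itv/= andbT.
have weak n : stopped_mass (@cell_mass R d m Q) (cell_osc Q f [::]) (sigma / 2) n [::]
    <= A * k `^ p / (sigma / 2) `^ p.
  apply: (@stopped_mass_weak _ _ _ _ _ _ _ _ D _ (cell_osc Q f)) => //.
  - exact: cell_massD.
  - exact: cell_mass_gt0 ha aQ.
  - exact: cell_oscD.
  - exact: cell_osc_ge0.
  - by move=> i w; exact: gauss_cell_doubling.
  - by move=> v; exact: cell_oscD.
  - exact: cell_osc_ge0.
  - exact: cell_osc_triangle ha aQ intf.
  - move=> s j; apply: (sum_cell_osc_le ha hp aQ mB intf KE) => x.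
    apply: le_trans (@sum_stopped_le _ _ _ _
      (fun w => (`[< cell Q w x >])%:R : R) _ _ _ _ _) _.
    + by apply: tree_additive_count; [exact: cell_child|exact: cell_inj].
    + by move=> w; rewrite ler0n.
    + by case: asboolP; rewrite ?ler01.
  (* [Kp_root] is the case of the collection consisting of [Q] alone. *)
  - have := sum_cell_osc_le (vs := [:: [::]]) ha hp aQ mB intf KE.
    rewrite big_seq1; apply=> x; rewrite big_seq1.
    by case: asboolP; rewrite ?ler01.
  - by rewrite divr_gt0.
have := approximable_mass_le (@measurable_cell R d m Q) (@cell_child R d m Q)
  (@cell_inj R d m Q) (cell_mass_gt0 ha aQ)
  (fun x => normr_ge0 (f x - cube_mean f Q))
  (integrable_osc intf (cube_mean f Q) (@measurable_cell R d m Q [::]))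
  (divr_gt0 s0 (ltr0Sn R 1)) mE (approximable_measurable m0 Q mE) weak.
have mc : measurable (cell Q ([::] : seq {ffun 'I_d -> 'I_m.+1})).
  exact: measurable_cell.
rewrite -lee_fin fineK; last by apply: fin_num_measure; exact: measurableI.
(* The half-open cube and the non-strict inequality only enlarge the set. *)
move=> H; apply: (@le_trans _ _ (gauss (cell Q ([::] : seq {ffun 'I_d -> 'I_m.+1})
    `&` [set x | 2 * (sigma / 2) <= h x]))).
  apply: le_measure; rewrite ?inE.
  - by apply: measurableI => //; exact: measurable_cube_set.
  - exact: measurableI.
  move=> x [Qx hx]; split; first exact: cube_set_sub.
  by rewrite /= mulrCA divff// mulr1; exact: ltW.
apply: (le_trans H); rewrite -[(k%:E * _)%E]EFinM poweR_EFin -EFinM lee_fin.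
have kE : k `^ p = (k * sigma^-1) `^ p * ((sigma / 2) `^ p * 2 `^ p).
  have s20 : 0 <= sigma / 2 by rewrite divr_ge0// ltW.
  have ks0 : 0 <= k * sigma^-1 by rewrite divr_ge0// ltW.
  rewrite -(powRM _ s20 (ler0n R 2)) divfK// -(powRM _ ks0 (ltW s0)).
  by rewrite divfK// gt_eqF.
rewrite kE; move: (_ `^ p) ((sigma / 2) `^ p) (powR_gt0 p (divr_gt0 s0 (ltr0Sn R 1))).
by move=> x y y0; rewrite le_eqVlt; apply/orP; left; apply/eqP; field; rewrite gt_eqF.
Qed.
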